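(* Let $C_m$ be the cyclic group of order $m$, let $V$ be a rational FPF representation of $C_m$ of dimension $n=\dim_{\mathbb{Q}}V$, let $L\subset V$ be a $C_m$-invariant full-rank lattice, and consider the induced FPF $C_m$-action on the $n$-dimensional torus $V_{\mathbb{C}}/L$. Let $F$ be the set of points of $V_{\mathbb{C}}/L$ with nontrivial stabilizer and $\pi\colon V_{\mathbb{C}}/L\to V_{\mathbb{C}}/(C_m\ltimes L)$ the canonical projection. Then the number of singular points of the quotient space $V_{\mathbb{C}}/(C_m\ltimes L)$ is \[|\pi(F)|=1-\frac{\omega(m)}{m}+\frac{1}{m}\sum_{p\mid m}p^{\frac{n}{p-1}}+\frac{1}{m}\sum_{p^k\mid m} \varphi(p^k)\Bigl(p^{\frac{n}{\varphi(p^k)}}-1\Bigr),\] where $p$ ranges over the distinct prime divisors of $m$, $p^k$ ranges over all prime power divisors of $m$ ($p$ prime, $k\geq 1$), and $\omega(m)$ is the number of distinct prime divisors of $m$.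
   Context: A rational FPF (fixed-point-free) representation of a finite group $G$ is a finite-dimensional $\mathbb{Q}$-vector space $V$ with a linear $G$-action such that $\det(g-\mathrm{id}\mid V)\neq 0$ for every non-identity $g\in G$. A $G$-invariant full-rank lattice $L\subset V$ is a $G$-stable free $\mathbb{Z}$-submodule spanned by a $\mathbb{Q}$-basis of $V$. Put $V_{\mathbb{C}}=V\otimes_{\mathbb{Q}}\mathbb{C}$; the action of $G$ extends $\mathbb{C}$-linearly to $V_{\mathbb{C}}$ and induces an action on the torus $V_{\mathbb{C}}/L\cong(\mathbb{C}/\mathbb{Z})^n$ by $g\cdot[x]=[gx]$, called an FPF $G$-action on the torus, with quotient $(V_{\mathbb{C}}/L)/G\cong V_{\mathbb{C}}/(G\ltimes L)$. The singular set of the quotient orbifold is taken to be $\pi(F)$, i.e. the set of images of points with nontrivial stabilizer. $\varphi$ is Euler's totient function.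
   Formalization: The formal theorem assumes m > 1; for the trivial group C_1 no point has nontrivial stabilizer, so |π(F)| = 0, while the stated formula gives 1. *)

(* Defs.v *)
From mathcomp Require Import all_boot all_order all_algebra all_fingroup.
From mathcomp Require Import mxrepresentation complex.
From mathcomp Require Import all_classical reals exp.

Set Implicit Arguments.
Unset Strict Implicit.
Unset Printing Implicit Defensive.

Import GRing.Theory.

Local Open Scope classical_set_scope.
Local Open Scope ring_scope.
Local Open Scope complex_scope.

(* A rational representation of dimension n is given in a basis: V is          *)
(* 'cV[rat]_n and g acts on the left, by x |-> rG g *m x; the complexification *)
(* V_C is 'cV[R[i]]_n, which contains V through map_mx ratr. The values of     *)
(* rG g are only meaningful for g \in G.                                       *)

Section Representation.
Context (gT : finGroupType) (G : {group gT}) (n : nat).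
Implicit Types (rG : mx_representation rat G n) (L : set 'cV[rat]_n).

Definition is_FPF rG :=
  forall g, g \in G -> g != 1%g -> \det (rG g - 1%:M) != 0.

Definition full_rank_lattice L :=
  exists b : n.-tuple 'cV[rat]_n,
    basis_of fullv b /\ L = [set v | inIntSpan b v].

Definition invariant_lattice rG L :=
  forall g x, g \in G -> L x -> L (rG g *m x).

End Representation.

Section TorusQuotient.
Context (R : realType) (gT : finGroupType) (G : {group gT}) (n : nat).
Implicit Types (rG : mx_representation rat G n) (L : set 'cV[rat]_n).
Implicit Types (x : 'cV[R[i]]_n) (T : set 'cV[R[i]]_n).

Definition complex_lattice L : set 'cV[R[i]]_n := map_mx ratr @` L.

Definition complex_act rG (g : gT) x : 'cV[R[i]]_n := map_mx ratr (rG g) *m x.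

(* The class [x] in V_C / L is the coset x + L, as a subset of V_C. *)
Definition lattice_coset L x : set 'cV[R[i]]_n :=
  [set x + l | l in complex_lattice L].

Definition torus L : set (set 'cV[R[i]]_n) := range (lattice_coset L).

(* g . [x] = [g x] when L is G-invariant: see torus_act_coset. *)
Definition torus_act rG (g : gT) T : set 'cV[R[i]]_n :=
  complex_act rG g @` T.

Definition torus_stabilizer rG T : {set gT} :=
  finset (fun g => (g \in G) && `[< torus_act rG g T = T >]).

(* F, as a set of points of the torus. *)
Definition nontrivial_stabilizer_points rG L : set (set 'cV[R[i]]_n) :=
  [set T | torus L T /\ torus_stabilizer rG T != 1%g].

(* The points of V_C / (G |x L): (g, l) acts on V_C by x |-> g x + l. *)
Definition affine_orbit rG L x : set 'cV[R[i]]_n :=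
  [set complex_act rG g x + l | g in [set` G] & l in complex_lattice L].

Definition quotient_space rG L : set (set 'cV[R[i]]_n) :=
  range (affine_orbit rG L).

(* The projection pi from V_C / L to V_C / (G |x L), taking [x] to the orbit   *)
(* of x: see quotient_proj_coset.                                              *)
Definition quotient_proj rG L T : set 'cV[R[i]]_n :=
  \bigcup_(x in T) affine_orbit rG L x.

Definition singular_points rG L : set (set 'cV[R[i]]_n) :=
  quotient_proj rG L @` nontrivial_stabilizer_points rG L.

Lemma torus_act_coset rG L g x :
  invariant_lattice rG L -> g \in G ->
  torus_act rG g (lattice_coset L x) = lattice_coset L (complex_act rG g x).
Proof.
move=> stabL gG; apply/seteqP; split.
- move=> _ [_ [_ [l Ll <-] <-] <-]; exists (map_mx ratr (rG g *m l)).
    by exists (rG g *m l) => //; exact: stabL.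
  by rewrite map_mxM /complex_act mulmxDr.
- move=> _ [_ [l Ll <-] <-].
  exists (x + map_mx ratr (rG g^-1%g *m l)).
    exists (map_mx ratr (rG g^-1%g *m l)) => //.
    by exists (rG g^-1%g *m l) => //; apply: stabL; rewrite ?groupV.
  rewrite /complex_act mulmxDr -map_mxM mulmxA -repr_mxM ?groupV //.
  by rewrite mulgV repr_mx1 mul1mx.
Qed.

Lemma quotient_proj_coset rG L x :
  full_rank_lattice L -> invariant_lattice rG L ->
  quotient_proj rG L (lattice_coset L x) = affine_orbit rG L x.
Proof.
move=> [b [_ LE]] stabL.
have L0 : L 0.
  rewrite LE /=; exists [ffun=> 0]; rewrite big1 // => i _.
  by rewrite ffunE mulr0z.
have LD u v : L u -> L v -> L (u + v).
  rewrite LE /= => -[s ->] [t ->]; exists [ffun i => s i + t i].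
  by rewrite -big_split; apply: eq_bigr => i _; rewrite ffunE mulrzDr.
apply/seteqP; split.
- move=> _ [_ [_ [l Ll <-] <-]] [g gG [_ [l' Ll' <-] <-]].
  exists g => //; exists (map_mx ratr (rG g *m l + l')).
    by exists (rG g *m l + l') => //; apply: LD => //; exact: stabL.
  by rewrite map_mxD map_mxM /complex_act mulmxDr addrA.
- move=> y xy; exists x => //; exists 0; last by rewrite addr0.
  by exists 0 => //; rewrite map_mx0.
Qed.

Lemma singular_points_quotient rG L :
  full_rank_lattice L -> invariant_lattice rG L ->
  singular_points rG L `<=` quotient_space rG L.
Proof.
move=> latL stabL _ [_ [[x _ <-] _] <-]; exists x => //.
by rewrite quotient_proj_coset.
Qed.

End TorusQuotient.

Arguments complex_lattice R {n} L.
Arguments torus R {n} L.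
Arguments nontrivial_stabilizer_points R {gT G n} rG L.
Arguments quotient_space R {gT G n} rG L.
Arguments singular_points R {gT G n} rG L.

(* Main.v *)
(* In a basis of L the group acts by integer matrices, and a point x of the
   torus is fixed by g <> 1 iff (1 - g) x = 0. For g of order p^k the product of
   the 1 - g^i over i prime to p equals 'Phi_(p^k)(1) = p, so the points fixed by
   g are p-torsion and, since all the g^i have the same ones as g, their number c
   satisfies c^phi(p^k) = p^n; if the order of g has two distinct prime divisors,
   only 0 is fixed. All these points are m-torsion, so that the singular points
   are the orbits of a finite module (Z/M)^n, which Burnside's formula counts.
   Taking M = m^2 instead of m makes the p-torsion divisible by p, whence the
   multiplicativity of the kernel cardinals that yields c^phi(p^k) = p^n. *)

Require Import Defs.
From mathcomp Require Import all_boot all_order all_algebra all_fingroup.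
From mathcomp Require Import all_solvable mxrepresentation complex finmap.
From mathcomp Require Import all_classical reals exp.
From mathcomp Require Import all_field ring.

Set Implicit Arguments.
Unset Strict Implicit.
Unset Printing Implicit Defensive.

Import Order.TTheory GRing.Theory Num.Theory.
Local Open Scope ring_scope.

(** * Cyclotomic polynomials of prime power order *)

Lemma perm_divisors_pfactorS p k : prime p ->
  perm_eq (divisors (p ^ k.+1)) (p ^ k.+1 :: divisors (p ^ k))%N.
Proof.
move=> pr_p; have pX_gt0 j : (0 < p ^ j)%N by rewrite expn_gt0 prime_gt0.
apply: uniq_perm => [||d]; first exact: divisors_uniq.
  rewrite /= divisors_uniq andbT -dvdn_divisors // dvdn_Pexp2l ?prime_gt1 //.
  by rewrite ltnn.
rewrite inE -!dvdn_divisors //; apply/idP/idP.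
  case/(dvdn_pfactor _ _ pr_p)=> j; rewrite leq_eqVlt => /orP[/eqP-> ->|].
    by rewrite eqxx.
  by rewrite ltnS => le_jk ->; rewrite dvdn_exp2l ?orbT.
case/orP=> [/eqP-> //|/dvdn_trans->//]; exact: dvdn_exp2l.
Qed.

Lemma Cyclotomic_pfactor p k : prime p ->
  'Phi_(p ^ k.+1) * ('X^(p ^ k) - 1) = 'X^(p ^ k.+1) - 1.
Proof.
move=> pr_p; have pX_gt0 j : (0 < p ^ j)%N by rewrite expn_gt0 prime_gt0.
rewrite -!prod_Cyclotomic // (perm_big _ (perm_divisors_pfactorS k pr_p)).
by rewrite big_cons.
Qed.

(** The polynomial is the geometric sum of the p powers of ['X^(p ^ k)], each of which is 1 at 1. *)
Lemma Cyclotomic_pfactor1 p k : prime p -> ('Phi_(p ^ k.+1)).[1] = p%:R.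
Proof.
move=> pr_p.
have nz : 'X^(p ^ k) - 1 != 0 :> {poly int}.
  by rewrite -size_poly_eq0 size_XnsubC // expn_gt0 prime_gt0.
suff -> : 'Phi_(p ^ k.+1) = \sum_(j < p) ('X^(p ^ k)) ^+ j.
  rewrite horner_sum (eq_bigr (fun=> 1)) => [|j _].
    by rewrite sumr_const card_ord.
  by rewrite !hornerE !expr1n.
apply: (mulIf nz).
by rewrite Cyclotomic_pfactor // mulrC -subrX1 -exprM -expnSr.
Qed.

(** At a primitive root of unity z of order q the product is ['Phi_q] evaluated at 1, hence p, so z
    is a root of the difference; and ['Phi_q] is the minimal polynomial of z over the rationals. *)
Lemma Cyclotomic_pfactor_dvd p k : prime p ->
  map_poly intr 'Phi_(p ^ k.+1) %|
    (\prod_(i < p ^ k.+1 | coprime i (p ^ k.+1)) (1 - 'X^i) - p%:R : {poly rat}).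
Proof.
move=> pr_p; set q := (p ^ k.+1)%N.
have q_gt0 : (0 < q)%N by rewrite expn_gt0 prime_gt0.
have [z prim_z] := C_prim_root_exists q_gt0.
have [f [f_z _ f_dvd]] := minCpolyP z.
have {f_z} -> : map_poly intr 'Phi_q = f.
  apply: (map_poly_inj (ratr : {rmorphism rat -> algC})).
  rewrite -f_z (minCpoly_cyclotomic prim_z) -(Cintr_Cyclotomic prim_z).
  by rewrite -map_poly_comp; apply: eq_map_poly => i /=; rewrite ratr_int.
rewrite -f_dvd rootE rmorphB rmorph_nat rmorph_prod !hornerE horner_prod /=.
rewrite -[p%:R]polyC_natr hornerC subr_eq0.
have <- : (cyclotomic z q).[1] = p%:R.
  rewrite -(Cintr_Cyclotomic prim_z) -[1](rmorph1 (intr : {rmorphism int -> algC})).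
  by rewrite horner_map Cyclotomic_pfactor1 //= rmorph_nat.
rewrite /cyclotomic horner_prod; apply/eqP/eq_bigr => i _.
by rewrite rmorphB rmorph1 !hornerE /= map_polyXn !hornerE.
Qed.

Lemma map_intr_mx_inj (F : numDomainType) m n :
  injective (map_mx intr : 'M[int]_(m, n) -> 'M[F]_(m, n)).
Proof.
move=> A B /matrixP eqAB; apply/matrixP => i j.
by have := eqAB i j; rewrite !mxE => /intr_inj.
Qed.

(** * Integral fixed-point-free representations *)

Section FixedPointFreeIntegral.

Variables (gT : finGroupType) (G : {group gT}) (n : nat).
Variable rZ : mx_representation int G n.
Hypothesis fpf : forall g, g \in G -> g != 1%g -> \det (rZ g - 1%:M) != 0.

(** The matrix of h is annihilated by ['Phi_(p ^ k.+1)]: it is annihilated by the product of this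
    polynomial with ['X^(p ^ k) - 1], and the second factor becomes invertible over the rationals
    because h^(p^k) is not 1. The preceding divisibility is then evaluated at this matrix. *)
Lemma prod_one_sub_repr h p k : prime p -> h \in G -> #[h]%g = (p ^ k.+1)%N ->
  \prod_(i < p ^ k.+1 | coprime i (p ^ k.+1)) (1 - rZ (h ^+ i)%g) = p%:R :> 'M_n.
Proof.
(* Dimension 0 is trivial; evaluating polynomials at a matrix is done in positive dimension. *)
move=> pr_p hG oh; case: n rZ fpf => [|n'] r r_fpf; first by apply/matrixP => [[]].
pose A : 'M[rat]_n'.+1 := map_mx intr (r h).
have rX i : map_mx intr (r (h ^+ i)%g) = A ^+ i.
  by rewrite repr_mxX // rmorphXn.
have Phi0 : horner_mx A (map_poly intr 'Phi_(p ^ k.+1)) = 0.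
  have unitB : A ^+ (p ^ k) - 1 \is a GRing.unit.
    rewrite -rX -(rmorph1 (map_mx (intr : int -> rat))) -rmorphB unitmxE /=.
    rewrite det_map_mx unitfE intr_eq0 r_fpf ?groupX //.
    by rewrite -order_dvdn oh dvdn_Pexp2l ?prime_gt1 // ltnn.
  apply: (mulIr unitB); rewrite mul0r.
  have /(congr1 (horner_mx A \o map_poly intr)) /= := Cyclotomic_pfactor k pr_p.
  rewrite !(rmorphM, rmorphB, rmorph1, rmorphXn) /= map_polyX horner_mx_X => ->.
  by rewrite -rX -oh expg_order repr_mx1 map_mx1 subrr.
apply: (@map_intr_mx_inj rat).
have /dvdpP[f /(congr1 (horner_mx A))] := Cyclotomic_pfactor_dvd k pr_p.
rewrite rmorphM /= Phi0 mulr0 rmorphB rmorph_nat => /eqP; rewrite subr_eq0.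
rewrite [X in _ -> X = _]rmorph_prod [X in _ -> _ = X]rmorph_nat => /eqP <-.
rewrite rmorph_prod; apply: eq_bigr => i _ /=.
by rewrite !rmorphB !rmorph1 /= rX rmorphXn /= horner_mx_X.
Qed.

End FixedPointFreeIntegral.

(** * Kernel cardinals over Z/M *)

Definition mxker (R : finComNzRingType) n (A : 'M[R]_n) : {set 'cV[R]_n} :=
  [set x | A *m x == 0].

(** Multiplication by B maps the kernel of [A *m B] onto that of A, with cosets of the kernel of B
    as fibres. *)
Lemma card_mxkerM (R : finComNzRingType) n (A B : 'M[R]_n) :
  (forall y : 'cV_n, A *m y = 0 -> exists x : 'cV_n, y = B *m x) ->
  #|mxker (A *m B)| = (#|mxker A| * #|mxker B|)%N.
Proof.
move=> surjB; rewrite -sum1_card (partition_big (mulmx B) (mem (mxker A))) /=.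
  rewrite -sum_nat_const; apply: eq_bigr => y; rewrite inE => /eqP Ay0.
  have [x0 Dy] := surjB y Ay0; rewrite sum1dep_card.
  rewrite -[RHS](card_imset _ (addrI x0)); apply: eq_card => x; rewrite !inE.
    apply/andP/imsetP => [[_ /eqP Bx]|[z]].
    exists (x - x0); last by rewrite addrC subrK.
    by rewrite inE mulmxBr Bx -Dy subrr.
  rewrite inE => /eqP Bz ->; rewrite -mulmxA mulmxDr Bz addr0 -Dy Ay0.
  by rewrite !eqxx.
by move=> x; rewrite !inE mulmxA.
Qed.

(** The hypothesis says that the kernel of the product lies in its image. Since the factors commute,
    the kernel of the first factor and that of the remaining product both lie in the image of the
    remaining product, so the induction goes through. *)
Lemma card_mxker_prod (R : finComNzRingType) n (I : Type) (s : seq I)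
    (P : pred I) (F : I -> 'M[R]_n) :
  (forall i j, F i *m F j = F j *m F i) ->
  (forall y : 'cV_n, (\prod_(i <- s | P i) F i) *m y = 0 ->
     exists x : 'cV_n, y = (\prod_(i <- s | P i) F i) *m x) ->
  #|mxker (\prod_(i <- s | P i) F i)| = (\prod_(i <- s | P i) #|mxker (F i)|)%N.
Proof.
move=> commF; elim: s => [|i s IHs]; rewrite ?(big_nil, big_cons).
  move=> _; rewrite (_ : mxker _ = [set 0]) ?cards1 //.
  by apply/setP => x; rewrite !inE mul1mx.
case: ifP => // _; set D := \prod_(j <- s | P j) F j => surjD.
have commD : F i *m D = D *m F i.
  rewrite /D; elim: s {IHs D surjD} => [|j s IHs]; rewrite ?(big_nil, big_cons).
    by rewrite mulmx1 mul1mx.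
  by case: ifP => // _; rewrite -!mulmxE mulmxA commF -!mulmxA IHs.
rewrite card_mxkerM ?IHs // => y y0.
  have [|x ->] := surjD y; first by rewrite -mulmxE -mulmxA y0 mulmx0.
  by exists (F i *m x); rewrite -mulmxE commD mulmxA.
have [|x ->] := surjD y; first by rewrite -mulmxE commD -mulmxA y0 mulmx0.
by exists (F i *m x); rewrite -mulmxE commD mulmxA.
Qed.

Lemma natmx_mul (R : pzRingType) n k (x : 'cV[R]_n) :
  (k%:R : 'M_n) *m x = x *+ k.
Proof.
by elim: k => [|k IHk]; rewrite ?mul0mx // mulrS mulmxDl mul1mx IHk mulrS.
Qed.

(** * The p-torsion of (Z/M)^n *)

Section ModularTorsion.

Variables (M p : nat).
Hypotheses (M_gt1 : (1 < M)%N) (p_gt0 : (0 < p)%N) (dvd_pM : (p %| M)%N).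

Lemma natZp_eq0 k : ((k%:R : 'Z_M) == 0) = (M %| k)%N.
Proof.
apply/eqP/idP => [/(congr1 val)|]; first by rewrite /= val_Zp_nat // => /eqP.
by move/eqP=> Mk; rewrite -(Zp_nat_mod M_gt1) Mk.
Qed.

Lemma intZp_eq0 (z : int) : ((z%:~R : 'Z_M) == 0) = (M %| z)%Z.
Proof.
by case: z => k; rewrite ?NegzE ?rmorphN ?oppr_eq0 natZp_eq0 dvdzE.
Qed.

Lemma mulrn_Zp_eq0P (a : 'Z_M) :
  reflect (exists2 i, (i < p)%N & a = (M %/ p * i)%:R) (a *+ p == 0).
Proof.
apply: (iffP idP) => [|[i _ ->]]; last first.
  by rewrite -mulrnA natZp_eq0 mulnAC divnK // dvdn_mulr.
rewrite -[a]natr_Zp -mulrnA natZp_eq0 -{1}(divnK dvd_pM) dvdn_pmul2r //.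
case/dvdnP=> i Da; exists i; last by rewrite Da mulnC.
have := ltn_ord a; rewrite [X in (_ < X)%N]Zp_cast // Da -{2}(divnK dvd_pM).
by rewrite mulnC ltn_pmul2l // divn_gt0 // dvdn_leq // ltnW.
Qed.

Lemma card_mulrn_Zp_eq0 : #|[set a : 'Z_M | a *+ p == 0]| = p.
Proof.
have q_gt0 : (0 < M %/ p)%N by rewrite divn_gt0 // dvdn_leq // ltnW.
transitivity #|[set ((M %/ p * i)%:R : 'Z_M) | i : 'I_p]|.
  apply: eq_card => a; rewrite inE.
  apply/mulrn_Zp_eq0P/imsetP => [[i i_p ->]|[i _ ->]]; last by exists i.
  by exists (Ordinal i_p).
rewrite card_imset ?card_ord // => i j /(congr1 val) /=.
have small (k : 'I_p) : (M %/ p * k < M)%N.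
  by rewrite -{2}(divnK dvd_pM) ltn_pmul2l.
rewrite !val_Zp_nat // !modn_small // => /eqP; rewrite eqn_pmul2l // => /eqP.
exact: val_inj.
Qed.

Lemma card_mxker_nat n : #|mxker (p%:R : 'M['Z_M]_n)| = (p ^ n)%N.
Proof.
pose col_ffun (f : {ffun 'I_n -> 'Z_M}) : 'cV['Z_M]_n := \col_i f i.
have inj_col : injective col_ffun.
  by move=> f g /colP eq_fg; apply/ffunP=> i; have := eq_fg i; rewrite !mxE.
rewrite -[RHS](congr2 expn card_mulrn_Zp_eq0 (card_ord n)) -card_ffun_on.
rewrite -(card_imset _ inj_col).
apply: eq_card => x; rewrite inE natmx_mul.
apply/eqP/imsetP => [px0|[f /ffun_onP Sf ->]].
  exists [ffun i => x i 0]; last by apply/colP=> i; rewrite mxE ffunE.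
  apply/ffun_onP=> i; rewrite ffunE inE; move/colP/(_ i)/eqP: px0.
  by rewrite mulmxnE mxE.
by apply/colP=> i; have := Sf i; rewrite inE mulmxnE !mxE => /eqP.
Qed.

(** The p-torsion of Z/M consists of the multiples of M/p, and p^2 dividing M makes M/p itself a
    multiple of p. *)
Lemma torsion_divisible n (y : 'cV['Z_M]_n) : (p * p %| M)%N ->
  y *+ p = 0 -> exists x, y = x *+ p.
Proof.
move=> dvd_ppM py0; exists (\col_i (y i 0 %/ p)%:R); apply/colP=> i.
have /mulrn_Zp_eq0P[j _ Dy] : y i 0 *+ p == 0 by rewrite -mulmxnE py0 mxE.
rewrite mulmxnE mxE -mulrnA divnK ?natr_Zp // Dy val_Zp_nat //.
have p_dvd_q : (p %| M %/ p)%N by rewrite dvdn_divRL.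
rewrite /dvdn modn_dvdm //; exact: dvdn_mulr.
Qed.

End ModularTorsion.

(** * Points fixed by one group element *)

Lemma order_expg_div (gT : finGroupType) (x : gT) d : (d %| #[x]%g)%N ->
  #[x ^+ (#[x] %/ d)]%g = d.
Proof. by move=> d_x; rewrite orderXdiv ?dvdn_div // divnA // mulKn // order_gt0. Qed.

Lemma coprime_torsion0 (V : zmodType) (x : V) p q :
  coprime p q -> x *+ p = 0 -> x *+ q = 0 -> x = 0.
Proof.
case: p => [|p] co_pq xp0 xq0.
  by move: co_pq xq0; rewrite /coprime gcd0n => /eqP->.
case: (egcdnP q (ltn0Sn p)) => a b Dab _.
by rewrite -[x]mulr1n -(eqnP co_pq) -[RHS](mul0rn _ a) -{1}xp0 -mulrnA mulnC Dab
           mulrnDr mulnC mulrnA xq0 mul0rn add0r.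
Qed.

(** C is the geometric sum 1 + h + ... + h^(i-1), built by induction. The base ring is general so
    that this serves both over the integers and over Z/M. *)
Lemma one_sub_reprX_factor (R : comUnitRingType) (gT : finGroupType)
    (G : {group gT}) n (r : mx_representation R G n) h i : h \in G ->
  exists C : 'M_n, 1 - r (h ^+ i)%g = C *m (1 - r h).
Proof.
move=> hG; elim: i => [|i [C DC]].
  by exists 0; rewrite expg0 repr_mx1 mul0mx subrr.
exists (C *m r h + 1); rewrite expgSr repr_mxM ?groupX // mulmxDl mul1mx.
have comm : (1 - r h) *m r h = r h *m (1 - r h).
  by rewrite mulmxBl mulmxBr mul1mx mulmx1.
rewrite -mulmxA -comm mulmxA -DC mulmxBl mul1mx.
by rewrite [RHS]addrC addrA subrK.
Qed.

Section ModularFixedPoints.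

Variables (gT : finGroupType) (G : {group gT}) (n M : nat).
Variable rZ : mx_representation int G n.
Hypothesis fpf : forall g, g \in G -> g != 1%g -> \det (rZ g - 1%:M) != 0.
Hypothesis M_gt1 : (1 < M)%N.

(** A power h' of h has order p, and p is the product of the 1 - h'^i, each of them a left multiple
    of 1 - h. Hence whatever 1 - h kills is p-torsion. *)
Lemma one_sub_repr_dvd h p : h \in G -> prime p -> (p %| #[h]%g)%N ->
  exists C : 'M[int]_n, C *m (1 - rZ h) = p%:R.
Proof.
move=> hG pr_p p_h; pose h' := (h ^+ (#[h] %/ p))%g.
have h'G : h' \in G by rewrite groupX.
have oh' : #[h']%g = (p ^ 1)%N.
  exact: order_expg_div.
have [C DC] := one_sub_reprX_factor rZ p.-1 h'G.
have [C' DC'] := one_sub_reprX_factor rZ (#[h]%g %/ p) hG.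
have := prod_one_sub_repr fpf pr_p h'G oh'.
(* Only the last factor is needed: its exponent p - 1 is prime to p, and 1 - h', then 1 - h, split
   off on its right. *)
rewrite expn1 -(prednK (prime_gt0 pr_p)) big_mkcond big_ord_recr /=.
rewrite (coprimePn (ltn0Sn _)) prednK ?prime_gt0 // DC DC' => <-.
set D := \prod_(i < _) _; exists (D *m (C *m C')).
by rewrite -mulmxE !mulmxA.
Qed.

Definition Zrepr : mx_representation 'Z_M G n := map_repr intr rZ.

(** The M-torsion points of the torus fixed by g, written as coordinate columns modulo M. *)
Definition fixcol g : {set 'cV['Z_M]_n} := mxker (1 - Zrepr g).

Lemma fixcolP g x : reflect (Zrepr g *m x = x) (x \in fixcol g).
Proof.
rewrite inE mulmxBl mul1mx subr_eq0; apply: (iffP eqP) => //.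
Qed.

Lemma fixcol0 g : 0 \in fixcol g.
Proof. by apply/fixcolP; rewrite mulmx0. Qed.

Lemma fixcol_cycle g h : g \in G -> h \in <[g]>%g -> fixcol g \subset fixcol h.
Proof.
move=> gG /cycleP[i ->]; apply/fintype.subsetP=> x; rewrite !inE => /eqP gx0.
have [C ->] := one_sub_reprX_factor Zrepr i gG.
by rewrite -mulmxA gx0 mulmx0.
Qed.

Lemma eq_fixcol g h : g \in G -> <[g]>%g = <[h]>%g -> fixcol g = fixcol h.
Proof.
move=> gG eq_gh; have hG : h \in G.
  by rewrite -cycle_subG -eq_gh cycle_subG.
apply/eqP; rewrite finset.eqEsubset !fixcol_cycle // ?cycle_id //.
  by rewrite -eq_gh cycle_id.
by rewrite eq_gh cycle_id.
Qed.

Lemma fixcol_torsion h p x : h \in G -> prime p -> (p %| #[h]%g)%N ->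
  x \in fixcol h -> x *+ p = 0.
Proof.
move=> hG pr_p p_h; rewrite inE => /eqP hx0.
have [C DC] := one_sub_repr_dvd hG pr_p p_h.
rewrite -natmx_mul -(rmorph_nat (map_mx (intr : int -> 'Z_M))) -DC.
by rewrite /= map_mxM rmorphB /= map_mx1 -mulmxA hx0 mulmx0.
Qed.

(** Multiplication by p, whose kernel has p^n elements, is the product of the 1 - h^i over the
    totient-many i prime to the order. Each h^i generates the same subgroup as h, so all factors
    have the same kernel. *)
Lemma card_fixcol h p k : h \in G -> prime p -> (p * p %| M)%N ->
    #[h]%g = (p ^ k.+1)%N ->
  (#|fixcol h| ^ totient (p ^ k.+1) = p ^ n)%N.
Proof.
move=> hG pr_p p2_M oh; have p_gt0 := prime_gt0 pr_p.
have p_M : (p %| M)%N by apply: dvdn_trans p2_M; apply: dvdn_mulr.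
set q := (p ^ k.+1)%N in oh *.
have prodE : \prod_(i < q | coprime i q) (1 - Zrepr (h ^+ i)%g) = p%:R.
  rewrite -(rmorph_nat (map_mx (intr : int -> 'Z_M))).
  rewrite -(prod_one_sub_repr fpf pr_p hG oh) rmorph_prod.
  by apply: eq_bigr => i _; rewrite rmorphB rmorph1.
have := card_mxker_nat M_gt1 p_gt0 p_M n; rewrite -prodE.
rewrite card_mxker_prod => [<-|i j|y].
- rewrite (eq_bigr (fun=> #|fixcol h|)) => [|i co_i].
    rewrite prod_nat_const totient_count_coprime big_mkord; congr (_ ^ _)%N.
        rewrite -[RHS]sum1_card [RHS]big_mkcond; apply: eq_bigr => i _.
    rewrite coprime_sym; change (coprime i q = (if coprime i q then 1 else 0) :> nat).
    by case: coprime.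
  apply/esym/eq_card => x; rewrite (@eq_fixcol _ (h ^+ i)%g) //; apply/eqP.
  by rewrite [_ == _]generator_coprime oh coprime_sym.
- have [ci cj] : (h ^+ i \in G /\ h ^+ j \in G)%g by rewrite !groupX.
  rewrite !(mulmxBl, mulmxBr, mul1mx, mulmx1) -!repr_mxM // -!expgD addnC.
  by rewrite !opprB !addrA [LHS]addrAC [RHS]addrAC [1 - _ - _]addrAC.
(* The kernel of the product lies in its image: p-torsion columns are divisible by p. *)
rewrite prodE natmx_mul => y0; have [x ->] := torsion_divisible M_gt1 p_gt0 p_M p2_M y0.
by exists x; rewrite natmx_mul.
Qed.

(** Two distinct primes divide the order of h, and a fixed column is torsion for both. *)
Lemma fixcol_eq0 h : h \in G -> h != 1%g ->
    (forall p k, prime p -> #[h]%g <> (p ^ k.+1)%N) -> fixcol h = [set 0].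
Proof.
move=> hG h_neq1 not_pp; apply/setP=> x; rewrite finset.in_set1.
apply/idP/eqP; last first.
  by move->; apply: fixcol0.
move=> x_h; have oh_gt1 : (1 < #[h]%g)%N by rewrite order_gt1.
pose p := pdiv #[h]%g; have pr_p : prime p by rewrite pdiv_prime.
have p_h : (p %| #[h]%g)%N := pdiv_dvd _.
have [q [q_p pr_q q_h]] : exists q, [/\ q != p, prime q & (q %| #[h]%g)%N].
  have: ~~ p.-nat #[h]%g.
    apply/negP=> /p_natP[[|k] oh]; first by rewrite oh in oh_gt1.
    exact: not_pp oh.
  rewrite /pnat order_gt0 => /allPn[q]; rewrite mem_primes => /and3P[? _ ?] ?.
  by exists q.
apply: (@coprime_torsion0 _ x p q); try exact: fixcol_torsion x_h.
by rewrite prime_coprime // dvdn_prime2 // eq_sym.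
Qed.

End ModularFixedPoints.

(** * Counting the singular orbits *)

Lemma pfactor_inj p q i j : prime p -> prime q -> (0 < i)%N ->
  (p ^ i = q ^ j)%N -> p = q /\ i = j.
Proof.
move=> pr_p pr_q i_gt0 eq_pq.
have eq_p_q : p = q.
  have: (p %| q ^ j)%N by rewrite -eq_pq dvdn_exp.
  rewrite Euclid_dvdX // dvdn_prime2 // => /andP[/eqP ->//].
by split=> //; apply/eqP; rewrite -(eqn_exp2l _ _ (prime_gt1 pr_p)) eq_pq eq_p_q.
Qed.

(** * Elements of given order in a cyclic group *)

Section CyclicOrder.

Variables (gT : finGroupType) (G : {group gT}).
Hypothesis cycG : cyclic G.

Lemma cyclic_eq_cycle a b : a \in G -> b \in G -> #[a]%g = #[b]%g ->
  <[a]>%g = <[b]>%g.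
Proof.
move=> aG bG oab; apply/eqP.
by rewrite (eq_subG_cyclic cycG) ?cycle_subG //; apply/eqP.
Qed.

(** Fixed points depend only on the subgroup generated, so one chosen element per order suffices to
    index them by orders. *)
Lemma cyclic_order_choice :
  exists e : nat -> gT, forall d, (d %| #|G|)%N -> e d \in G /\ #[e d]%g = d.
Proof.
have [x ->] := cyclicP cycG; rewrite -orderE.
exists (fun d => x ^+ (#[x] %/ d))%g => d d_x; rewrite mem_cycle.
by rewrite order_expg_div.
Qed.

Lemma cyclic_card_order d : (d %| #|G|)%N ->
  #|[set a in G | #[a]%g == d]| = totient d.
Proof.
have [e eP] := cyclic_order_choice; move=> /eP[]; move: (e d) => a aG <-.
rewrite totient_gen; apply: eq_card => b.
rewrite !inE; apply/andP/eqP => [[bG /eqP/esym/(cyclic_eq_cycle aG bG)]|] // eq_ab.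
have bG : b \in G by rewrite -cycle_subG -eq_ab cycle_subG.
by rewrite bG /order eq_ab.
Qed.

End CyclicOrder.

(** * Burnside count on the singular columns *)

Section SingularOrbits.

Variables (gT : finGroupType) (G : {group gT}) (n M : nat).
Variable rZ : mx_representation int G n.
Hypothesis fpf : forall g, g \in G -> g != 1%g -> \det (rZ g - 1%:M) != 0.
Hypothesis cycG : cyclic G.
Hypothesis G_gt1 : (1 < #|G|)%N.

Local Notation fixcol := (fixcol M rZ).
Local Notation A := (Zrepr M rZ).

Definition singcol : {set 'cV['Z_M]_n} :=
  \bigcup_(g in G | g != 1%g) fixcol g.

(* The identity outside G: an action must be injective for every group element,
   even outside its domain. *)
Definition colact (x : 'cV['Z_M]_n) g := if g \in G then A g *m x else x.

Lemma colact_is_action : is_action G colact.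
Proof.
split=> [g x y|x g h gG hG]; rewrite /colact.
  case: ifP => // gG eq_gxy; rewrite -[x]mul1mx -[y]mul1mx -(repr_mx1 A).
  by rewrite -(mulVg g) repr_mxM ?groupV // -!mulmxA eq_gxy.
rewrite groupM // gG hG mulmxA -repr_mxM //; congr (A _ *m x).
(* Actions compose on the right while matrices multiply on the left; commutativity of G reconciles
   the two. *)
by apply: (centsP (cyclic_abelian cycG)).
Qed.

Canonical col_action := Action colact_is_action.

Lemma colactE x g : g \in G -> colact x g = A g *m x.
Proof. by rewrite /colact => ->. Qed.

Lemma col_actionE x g : g \in G -> col_action x g = A g *m x.
Proof. exact: colactE. Qed.

Lemma colactX_singcol g x : g \in G -> (colact x g \in singcol) = (x \in singcol).
Proof.
have imp h y : h \in G -> y \in singcol -> colact y h \in singcol.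
  move=> hG /bigcupP[a /andP[aG a_neq1] /fixcolP ya].
  apply/bigcupP; exists a; rewrite ?aG //; apply/fixcolP.
  rewrite colactE // mulmxA -repr_mxM // (centsP (cyclic_abelian cycG) a _ h) //.
  by rewrite repr_mxM // -mulmxA ya.
move=> gG; apply/idP/idP=> [|/imp->//] /(imp g^-1%g); rewrite groupV => /(_ gG).
by rewrite !colactE ?groupV // mulmxA -repr_mxM ?groupV // mulVg repr_mx1 mul1mx.
Qed.

(** Burnside's formula on [singcol]: the identity fixes all of it, and any other g has all its fixed
    columns inside it. *)
Lemma sum_card_fixcol :
  (#|singcol| + \sum_(g in G | g != 1%g) #|fixcol g| =
   #|orbit col_action G @: singcol| * #|G|)%N.
Proof.
rewrite -Frobenius_Cauchy; last first.
  apply/fintype.subsetP=> g gG; rewrite !inE gG; apply/fintype.subsetP=> x xS.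
  by rewrite inE [_ \in _]colactX_singcol.
rewrite [RHS](bigD1 1%g) //=; congr (_ + _)%N.
  apply: eq_card => x; rewrite !inE finset.sub1set inE.
  by rewrite col_actionE // repr_mx1 mul1mx eqxx andbT.
apply: eq_bigr => g /andP[gG g_neq1]; apply: eq_card => x.
rewrite finset.in_setI; apply/idP/andP => [xg|[_]]; last first.
  by move/afix1P; rewrite col_actionE // => /fixcolP.
split; first by apply/bigcupP; exists g; rewrite ?gG.
by apply/afix1P; rewrite col_actionE //; apply/fixcolP.
Qed.

Variable c : nat -> nat.
Hypothesis card_c : forall g, g \in G -> #|fixcol g| = c #[g]%g.

(** A nonzero singular column is fixed by an element of prime order p for exactly one p, since two
    such primes would make it torsion for both. The nonzero singular columns are thus partitioned by
    the primes dividing the order of G. *)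
Lemma card_singcol (F : nzRingType) :
  #|singcol|%:R = 1 + \sum_(p <- primes #|G|) ((c p)%:R - 1) :> F.
Proof.
have s0 : 0 \in singcol.
  have /trivgPn[g gG g_neq1] : G :!=: 1%g by rewrite -cardG_gt1.
  by apply/bigcupP; exists g; rewrite ?gG //; apply: fixcol0.
have [e eP] := cyclic_order_choice cycG.
have primesP p : p \in primes #|G| -> prime p /\ (p %| #|G|)%N.
  by rewrite mem_primes => /and3P[].
rewrite (cardsD1 0) s0 natrD; congr (1 + _).
(* Double counting: for each nonzero x, the sum over p is the indicator of [singcol]. *)
transitivity (\sum_(p <- primes #|G|) \sum_(x | x != 0) (x \in fixcol (e p))%:R : F).
  rewrite exchange_big -sum1_card natr_sum big_mkcond [RHS]big_mkcond /=.
  apply: eq_bigr => x _; rewrite finset.in_setD1; case: eqP => //= /eqP x_neq0.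
  transitivity ((x \in singcol)%:R : F); first by case: (x \in singcol).
  have [/bigcupP[g /andP[gG g_neq1] xg]|x_reg] := boolP (x \in singcol).
    have og_gt1 : (1 < #[g]%g)%N by rewrite order_gt1.
    have pr_p := pdiv_prime og_gt1; have p_g := pdiv_dvd #[g]%g.
    move: (pdiv _) pr_p p_g => p pr_p p_g.
    have p_G : (p %| #|G|)%N := dvdn_trans p_g (order_dvdG gG).
    have [epG oep] := eP p p_G.
    have x_ep : x \in fixcol (e p).
      have hG : (g ^+ (#[g] %/ p))%g \in G by rewrite groupX.
      have := fintype.subsetP (fixcol_cycle M rZ gG (mem_cycle g (#[g]%g %/ p))) x xg.
      rewrite (@eq_fixcol _ _ _ M rZ _ (e p)) //; apply: (cyclic_eq_cycle cycG) => //.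
      by rewrite oep order_expg_div.
    rewrite (bigD1_seq p) ?primes_uniq ?mem_primes ?pr_p ?p_G ?cardG_gt0 //= x_ep.
    rewrite big1_seq ?addr0 // => q /andP[q_neq_p /primesP[pr_q q_G]].
    have [eqG oeq] := eP q q_G; case: (boolP (x \in _)) => // x_eq.
    case/eqP: x_neq0; apply: (@coprime_torsion0 _ x p q).
    - by rewrite prime_coprime // dvdn_prime2 // eq_sym.
    - by apply: (fixcol_torsion fpf epG pr_p _ x_ep); rewrite oep.
    - by apply: (fixcol_torsion fpf eqG pr_q _ x_eq); rewrite oeq.
  rewrite big1_seq // => p /andP[_ /primesP[pr_p p_G]].
  have [epG oep] := eP p p_G; case: (boolP (x \in _)) => // x_ep.
  case/bigcupP: x_reg; exists (e p); rewrite // epG -order_gt1 oep.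
  exact: prime_gt1.
apply: eq_big_seq => p /primesP[_ /eP[epG oep]].
rewrite -{2}oep -card_c // (cardsD1 0) fixcol0 natrD addrC addKr.
rewrite -sum1_card natr_sum big_mkcond [RHS]big_mkcond; apply: eq_bigr => x _.
by rewrite finset.in_setD1; case: eqP => //=; case: (x \in _).
Qed.

(** The column 0 accounts for |G| - 1. The excess c(d) - 1 of an element of order d vanishes unless
    d is a prime power, and [totient d] elements have order d. *)
Lemma sum_card_fixcol_neq1 (F : nzRingType) :
  (\sum_(g in G | g != 1%g) #|fixcol g|)%:R =
    #|G|%:R - 1 + \sum_(p <- primes #|G|)
      \sum_(1 <= k < #|G|.+1 | (p ^ k %| #|G|)%N)
        (totient (p ^ k))%:R * ((c (p ^ k))%:R - 1) :> F.
Proof.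
have -> : #|G|%:R - 1 = \sum_(g in G | g != 1%g) 1 :> F.
  by rewrite -sum1_card (bigD1 1%g) //= natrD addrC addKr natr_sum.
rewrite natr_sum addrC -(subrK (\sum_(g in G | g != 1%g) 1) (\sum_(_ | _) _)).
congr (_ + _); rewrite -sumrB.
pose m := #|G|.
(* The excess of g is spread over all pairs (p, k), of which at most one satisfies p^k = #[g]. *)
transitivity (\sum_(g in G | g != 1%g) \sum_(p <- primes m)
   \sum_(1 <= k < m.+1 | (p ^ k %| m)%N)
      (#[g]%g == p ^ k)%N%:R * ((c (p ^ k))%:R - 1) : F); last first.
  rewrite exchange_big; apply: eq_big_seq => p.
  rewrite mem_primes => /and3P[pr_p _ p_G].
  rewrite exchange_big big_nat_cond [RHS]big_nat_cond.
  apply: eq_bigr => k /andP[/andP[k_gt0 _] pk_m] /=.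
  rewrite -mulr_suml -(cyclic_card_order cycG pk_m) -natr_sum -sum1_card.
  congr (_%:R * _); rewrite big_mkcond [RHS]big_mkcond; apply: eq_bigr => g _.
  rewrite inE; case: (g \in G) => //=; case: (altP (g =P 1%g)) => [->|_].
    by rewrite order1 eq_sym gtn_eqF // -(exp1n k) ltn_exp2r ?prime_gt1.
  by case: eqP.
apply: eq_bigr => g /andP[gG g_neq1]; rewrite card_c //.
have og_gt1 : (1 < #[g]%g)%N by rewrite order_gt1.
have pr_p := pdiv_prime og_gt1.
have [/p_natP[k og]|not_pp] := boolP ((pdiv #[g]%g).-nat #[g]%g); last first.
  have c1 : c #[g]%g = 1%N.
    rewrite -card_c // (fixcol_eq0 M fpf gG g_neq1) ?cards1 // => q j pr_q og.
    by case/negP: not_pp; rewrite og pdiv_pfactor // pnatX pnat_id.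
  rewrite c1 subrr big1_seq // => q /andP[_]; rewrite mem_primes => /and3P[pr_q _ _].
  rewrite big_nat_cond big1 // => j /andP[/andP[j_gt0 _] _].
  case: eqP => [og|_]; last by rewrite mul0r.
  by case/negP: not_pp; rewrite og -(prednK j_gt0) pdiv_pfactor // pnatX pnat_id.
move: (pdiv _) pr_p og => p pr_p og.
have k_gt0 : (0 < k)%N by move: og_gt1; rewrite og; case: (k).
have pk_m : (p ^ k %| m)%N by rewrite -og order_dvdG.
have p_m : (p %| m)%N by apply: dvdn_trans pk_m; rewrite dvdn_exp.
(* The summation range misses no exponent, as k < p^k <= m. *)
have k_m : (k < m.+1)%N.
  by rewrite ltnS (leq_trans (ltnW (ltn_expl k (prime_gt1 pr_p)))) // dvdn_leq ?cardG_gt0.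
rewrite (bigD1_seq p) ?primes_uniq ?mem_primes ?pr_p ?p_m ?cardG_gt0 //=.
rewrite [X in _ = _ + X]big1_seq ?addr0 => [|q /andP[q_neq_p]]; last first.
  rewrite mem_primes => /and3P[pr_q _ _]; apply: big1 => j _; rewrite og.
  case: eqP => [/pfactor_inj[]// eq_pq|_]; last by rewrite mul0r.
  by rewrite eq_pq eqxx in q_neq_p.
rewrite big_mkcond (bigD1_seq k) ?iota_uniq ?mem_index_iota ?k_gt0 //=.
rewrite pk_m og eqxx mul1r big1 ?addr0 // => j j_neq_k.
case: ifP => // _; case: eqP => [/pfactor_inj[]// _ eq_kj|_]; last by rewrite mul0r.
by rewrite eq_kj eqxx in j_neq_k.
Qed.

End SingularOrbits.

(** * From the torus to Z/M *)

Local Open Scope classical_set_scope.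
Local Open Scope complex_scope.

Lemma size_undup_map (T A B : eqType) (f : T -> A) (g : T -> B) s :
  {in s &, forall x y, f x = f y <-> g x = g y} ->
  size (undup (map f s)) = size (undup (map g s)).
Proof.
elim: s => //= x s IHs fg.
have {}IHs : size (undup (map f s)) = size (undup (map g s)).
  by apply: IHs => y z ys zs; apply: fg; rewrite inE ?ys ?zs orbT.
suff -> : (f x \in map f s) = (g x \in map g s) by case: ifP; rewrite /= IHs.
by apply/mapP/mapP=> -[y ys /fg]; rewrite !inE eqxx ys orbT => /(_ isT isT);
  exists y.
Qed.

(** Maps with the same fibres on S have equinumerous images; this carries the count of orbits of
    columns over to orbits in the complex space. *)
Lemma card_fset_set_image (T U : finType) (A : choiceType) (S : {set T})
    (f : T -> A) (g : T -> U) :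
  {in S &, forall x y, f x = f y <-> g x = g y} ->
  finite_set (f @` [set` S]) /\ #|` fset_set (f @` [set` S])| = #|g @: S|.
Proof.
move=> fg.
have -> : f @` [set` S] = [set` seq_fset tt (map f (enum S))].
  apply/seteqP; split=> y /=.
    case=> x xS <-; change (f x \in seq_fset tt (map f (enum S))).
    by rewrite seq_fsetE map_f ?mem_enum.
  change (y \in seq_fset tt (map f (enum S)) -> (f @` [set` S]) y).
  by rewrite seq_fsetE => /mapP[x]; rewrite mem_enum => xS ->; exists x.
split; first exact: finite_fset.
rewrite set_fsetK size_seq_fset (@size_undup_map _ _ _ f g); last first.
  by move=> x y; rewrite !mem_enum; apply: fg.
rewrite -(card_uniqP (undup_uniq _)); apply: eq_card => y; rewrite mem_undup.
apply/mapP/imsetP => -[x xS ->]; exists x; rewrite ?mem_enum //.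
by rewrite -mem_enum.
Qed.

Lemma lattice_basis n (L : set 'cV[rat]_n) : full_rank_lattice L ->
  exists2 P : 'M[rat]_n, P \in unitmx &
    forall v, L v <-> exists z : 'cV[int]_n, v = P *m map_mx intr z.
Proof.
case=> b [/andP[/eqP b_full _] ->]; pose P : 'M[rat]_n := \matrix_(i, j) b`_j i 0.
have PE (u : 'cV[rat]_n) : P *m u = \sum_j u j 0 *: b`_j.
  apply/colP=> i; rewrite mxE summxE; apply: eq_bigr => j _.
  by rewrite !mxE mulrC.
exists P.
  (* The columns of Q are the coordinates of the standard basis in b, which makes Q inverse to P. *)
  pose Q : 'M[rat]_n := \matrix_(i, j) coord b i (delta_mx j 0).
  suff /mulmx1_unit[] : P *m Q = 1%:M by [].
  apply/matrixP=> i j.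
  have /coord_span : delta_mx j 0 \in <<b>>%VS by rewrite b_full memvf.
  move/colP/(_ i); rewrite !mxE eqxx andbT => ->.
  rewrite summxE; apply: eq_bigr => k _; by rewrite !mxE mulrC.
move=> v; split=> [[a ->]|[z ->]].
  exists (\col_i a i); rewrite PE; apply: eq_bigr => j _.
  by rewrite !mxE scaler_int.
exists [ffun i => z i 0]; rewrite PE; apply: eq_bigr => j _.
by rewrite !mxE ffunE scaler_int.
Qed.

(** * Coordinates in a basis of the lattice *)

Section LatticeCoordinates.

Variables (gT : finGroupType) (G : {group gT}) (n : nat).
Variables (rG : mx_representation rat G n) (L : set 'cV[rat]_n) (P : 'M[rat]_n).
Hypothesis unitP : P \in unitmx.
Hypothesis LE : forall v, L v <-> exists z : 'cV[int]_n, v = P *m map_mx intr z.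

(** Each column of P lies in L, so its image under g has integer coordinates. These form the matrix
    of g in the basis P, which is multiplicative since P is invertible. *)
Lemma integral_repr : invariant_lattice rG L ->
  exists rZ : mx_representation int G n,
    forall g, g \in G -> rG g *m P = P *m map_mx intr (rZ g).
Proof.
move=> stabL.
have [N NE] : exists N : gT -> 'M[int]_n,
    forall g, g \in G -> rG g *m P = P *m map_mx intr (N g).
  suff /choice[N NE] : forall g, exists N : 'M[int]_n,
     g \in G -> rG g *m P = P *m map_mx intr N by exists N.
  move=> g; case gG : (g \in G); last by exists 0.
  have /choice[z zE] : forall j, exists z : 'cV[int]_n,
      rG g *m col j P = P *m map_mx intr z.
    move=> j; apply/LE/stabL => //; apply/LE; exists (delta_mx j 0).
    by rewrite map_delta_mx colE.
  exists (\matrix_(i, j) z j i 0) => _; apply/matrixP=> i j.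
  have /colP/(_ i) := zE j; rewrite colE mulmxA -colE 3!mxE => ->.
  by rewrite mxE; apply: eq_bigr => k _; rewrite !mxE.
have N_repr : mx_repr G N.
  split=> [|g h gG hG]; apply: (@map_intr_mx_inj rat);
    apply: (can_inj (mulKmx unitP)); rewrite -NE ?group1 ?groupM //.
    by rewrite repr_mx1 map_mx1 mul1mx mulmx1.
  by rewrite map_mxM mulmxA -NE // -mulmxA -NE // mulmxA -repr_mxM.
by exists (MxRepresentation N_repr).
Qed.

Variable rZ : mx_representation int G n.
Hypothesis rZE : forall g, g \in G -> rG g *m P = P *m map_mx intr (rZ g).

Lemma integral_fpf : is_FPF rG ->
  forall g, g \in G -> g != 1%g -> \det (rZ g - 1%:M) != 0.
Proof.
move=> fpf g gG /(fpf g gG); apply: contra => /eqP det0.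
have : \det ((rG g - 1%:M) *m P) = \det (P *m map_mx intr (rZ g - 1%:M)).
  by rewrite mulmxBl rZE // map_mxB map_mx1 mulmxBr mul1mx mulmx1.
rewrite !det_mulmx det_map_mx det0 rmorph0 mulr0 => /eqP.
by rewrite mulf_eq0 orbC -[\det P == 0]negbK -unitfE -unitmxE unitP.
Qed.

Variables (R : realType) (M : nat).
Hypothesis M_gt1 : (1 < M)%N.
Local Notation C := R[i].
Local Notation PC := (map_mx ratr P : 'M[C]_n).
Local Notation cint := (map_mx (intr : int -> C)).
Local Notation Zp := (map_mx (intr : int -> 'Z_M)).

(** The vector with coordinates w/M in the basis P; modulo L it is an M-torsion point that depends
    only on w modulo M. *)
Definition lattice_point (w : 'cV[int]_n) : 'cV[C]_n :=
  PC *m (M%:R^-1 *: cint w).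

Lemma unitPC : PC \in unitmx. Proof. by rewrite map_unitmx. Qed.

Lemma map_ratr_int m k (N : 'M[int]_(m, k)) :
  map_mx (ratr : rat -> C) (map_mx intr N) = cint N.
Proof. by apply/matrixP=> i j; rewrite !mxE ratr_int. Qed.

Lemma complex_latticeE v :
  complex_lattice R L v <-> exists z : 'cV[int]_n, v = PC *m cint z.
Proof.
split=> [[l /LE[z ->] <-]|[z ->]]; first by exists z; rewrite map_mxM map_ratr_int.
exists (P *m map_mx intr z); first by apply/LE; exists z.
by rewrite map_mxM map_ratr_int.
Qed.

Lemma complex_actE g u : g \in G ->
  complex_act rG g (PC *m u) = PC *m (cint (rZ g) *m u).
Proof.
move=> gG; rewrite /complex_act !mulmxA -map_mxM rZE; last exact: gG.
by rewrite map_mxM map_ratr_int.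
Qed.

Lemma Zp_colP (w w' : 'cV[int]_n) :
  Zp w = Zp w' <-> exists z, w = w' + z *+ M.
Proof.
split=> [eq_ww'|[z ->]]; last first.
  have M0 : M%:R = 0 :> 'Z_M by apply/eqP; rewrite natZp_eq0.
  by rewrite map_mxD raddfMn /= -scaler_nat M0 scale0r addr0.
have /choice[z zE] : forall i, exists t : int, w i 0 = w' i 0 + t *+ M.
  move=> i; have /colP/(_ i) := eq_ww'; rewrite !mxE => /eqP.
  rewrite -subr_eq0 -rmorphB /= intZp_eq0 // => /dvdzP[t Dt]; exists t.
  by rewrite -mulr_natr natz -Dt addrC subrK.
exists (\col_i z i); apply/colP=> i.
by rewrite mxE mulmxnE mxE -zE.
Qed.

Lemma lattice_point_congr (w w' : 'cV[int]_n) :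
  Zp w = Zp w' <->
  exists2 l, complex_lattice R L l & lattice_point w = lattice_point w' + l.
Proof.
have M_neq0 : M%:R != 0 :> C by rewrite pnatr_eq0 -lt0n ltnW.
rewrite Zp_colP; split=> [[z ->]|[l /complex_latticeE[z ->]]].
  exists (PC *m cint z); first by apply/complex_latticeE; exists z.
  rewrite /lattice_point -mulmxDr map_mxD scalerDr raddfMn /=.
  by rewrite -[cint z *+ M]scaler_nat scalerA mulVf // scale1r.
rewrite /lattice_point -mulmxDr => /(can_inj (mulKmx unitPC)).
move/(congr1 ( *:%R M%:R)); rewrite scalerDr !scalerA divff // !scale1r => E.
exists z; apply: (@map_intr_mx_inj C).
by rewrite E map_mxD raddfMn /= scaler_nat.
Qed.

Lemma lattice_point_act g w : g \in G ->
  complex_act rG g (lattice_point w) = lattice_point (rZ g *m w).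
Proof.
by move=> gG; rewrite /lattice_point complex_actE // -scalemxAr map_mxM.
Qed.

Lemma affine_orbit_lattice_point w w' :
  affine_orbit rG L (lattice_point w) (lattice_point w') <->
  exists2 g, g \in G & Zp (rZ g *m w) = Zp w'.
Proof.
split=> [[g gG [l Ll E]]|[g gG E]].
  exists g; first exact: gG.
  apply/esym/lattice_point_congr; exists l; first exact: Ll.
  by rewrite -lattice_point_act.
have /lattice_point_congr[l Ll E'] := esym E.
exists g; first exact: gG.
exists l; first exact: Ll.
by rewrite lattice_point_act.
Qed.

Hypothesis stabL : invariant_lattice rG L.

Lemma latticeB l l' : complex_lattice R L l -> complex_lattice R L l' ->
  complex_lattice R L (l - l').
Proof.
move=> /complex_latticeE[z ->] /complex_latticeE[z' ->].
by apply/complex_latticeE; exists (z - z'); rewrite map_mxB mulmxBr.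
Qed.

Lemma lattice0 : complex_lattice R L 0.
Proof. by apply/complex_latticeE; exists 0; rewrite map_mx0 mulmx0. Qed.

Lemma lattice_act g l : g \in G -> complex_lattice R L l ->
  complex_lattice R L (complex_act rG g l).
Proof.
move=> gG /complex_latticeE[z ->]; rewrite complex_actE //.
by apply/complex_latticeE; exists (rZ g *m z); rewrite map_mxM.
Qed.

Lemma lattice_coset_eq (x y : 'cV[C]_n) :
  lattice_coset L x = lattice_coset L y <-> complex_lattice R L (x - y).
Proof.
split=> [E|Lxy].
  have : lattice_coset L x x by exists 0; [exact: lattice0 | rewrite addr0].
  by rewrite E => -[l Ll <-]; rewrite addrC addKr.
apply/seteqP; split=> _ [l Ll <-].
  exists (x - y + l); last by rewrite addrA [y + _]addrC subrK.
  by rewrite -[l]opprK -[- l]sub0r; apply/latticeB/latticeB => //; exact: lattice0.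
exists (l - (x - y)); first exact: latticeB.
by rewrite opprB addrCA [x + _]addrC subrK addrC.
Qed.

Lemma affine_orbit_eq (x y : 'cV[C]_n) : affine_orbit rG L x y ->
  affine_orbit rG L x = affine_orbit rG L y.
Proof.
case=> g gG [l Ll <-].
have actM a b u : a \in G -> b \in G ->
    complex_act rG a (complex_act rG b u) = complex_act rG (a * b)%g u :> 'cV[C]_n.
  by move=> aG bG; rewrite /complex_act mulmxA -map_mxM repr_mxM.
have actD a u v :
    complex_act rG a (u + v) = complex_act rG a u + complex_act rG a v :> 'cV[C]_n.
  by rewrite /complex_act mulmxDr.
apply/seteqP; split=> _ [h hG [l' Ll' <-]]; rewrite /= in gG hG.
  exists (h * g^-1)%g; first by rewrite /= groupM ?groupV.
  (* As y = g x + l, applying h g^-1 to y gives h x plus the image of l, which the translation has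
     to cancel. *)
  exists (l' - complex_act rG (h * g^-1)%g l).
    by apply: latticeB => //; apply: lattice_act; rewrite ?groupM ?groupV.
  by rewrite actD actM ?groupM ?groupV // mulgKV addrACA subrr addr0.
exists (h * g)%g; first by rewrite /= groupM.
exists (complex_act rG h l + l'); last by rewrite -actM // actD addrA.
rewrite -[l']opprK -[- l']sub0r; apply: latticeB; first exact: lattice_act.
by apply: latticeB => //; exact: lattice0.
Qed.

Hypothesis latL : full_rank_lattice L.
Hypothesis fpf : is_FPF rG.
Hypothesis dvd_M : forall p, prime p -> (p %| #|G|)%N -> (p %| M)%N.

Definition lift_point (x : 'cV['Z_M]_n) : 'cV[C]_n :=
  lattice_point (map_mx (fun a : 'Z_M => (a : nat)%:Z) x).

Lemma lift_pointK (x : 'cV['Z_M]_n) :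
  Zp (map_mx (fun a : 'Z_M => (a : nat)%:Z) x) = x.
Proof. by apply/colP=> i; rewrite !mxE -pmulrn natr_Zp. Qed.

(** If p divides the order of g, then p is a left multiple of 1 - g, so (g - 1) x in L forces p x in
    L; as p divides M, x is M-torsion. *)
Lemma fixed_point_lattice_point g x : g \in G -> g != 1%g ->
    complex_lattice R L (complex_act rG g x - x) ->
  exists2 w, x = lattice_point w & Zp w \in fixcol M rZ g.
Proof.
move=> gG g_neq1; have [u ->] : exists u, x = PC *m u.
  by exists (invmx PC *m x); rewrite mulKVmx // unitPC.
rewrite complex_actE // -mulmxBr => /complex_latticeE[z].
move=> /(can_inj (mulKmx unitPC)) Dz.
have og_gt1 : (1 < #[g]%g)%N by rewrite order_gt1.
have pr_p := pdiv_prime og_gt1; have p_g := pdiv_dvd #[g]%g.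
move: (pdiv _) pr_p p_g => p pr_p p_g.
have [D DE] := one_sub_repr_dvd (integral_fpf fpf) gG pr_p p_g.
have p_M : (p %| M)%N by apply: dvd_M => //; apply: dvdn_trans (order_dvdG gG).
have M_neq0 : M%:R != 0 :> C by rewrite pnatr_eq0 -lt0n ltnW.
(* From D (1 - g) = p and (1 - g) u = -z follows p u = -D z; multiplying by M/p gives w = M u. *)
pose w := (- (D *m z)) *+ (M %/ p).
have Dw : cint w = M%:R *: u.
  have pu : cint (- (D *m z)) = u *+ p.
    rewrite map_mxN map_mxM -Dz -mulmxN opprB -{1}[u]mul1mx -mulmxBl mulmxA.
    rewrite -(map_mx1 (intr : int -> C)) -map_mxB -map_mxM DE -natmx_mul.
    by rewrite -(rmorph_nat (cint : {rmorphism _ -> _})).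
  by rewrite raddfMn /= pu -mulrnA mulnC divnK // scaler_nat.
move: w Dw => w Dw; exists w.
  by rewrite /lattice_point Dw scalerA mulVf // scale1r.
apply/fixcolP; rewrite -map_mxM; apply/Zp_colP; exists z.
apply: (@map_intr_mx_inj C); rewrite map_mxD map_mxM raddfMn /= Dw -Dz.
by rewrite -scalemxAr !scaler_nat mulrnBl addrC subrK.
Qed.

(** Points with nontrivial stabilizer are M-torsion, hence given by columns modulo M; conversely a
    column fixed modulo M lifts to a vector fixed modulo L. *)
Lemma singular_points_lift :
  singular_points R rG L = (affine_orbit rG L \o lift_point) @` [set` singcol M rZ].
Proof.
apply/seteqP; split=> [_ [_ [[x _ <-] stab_neq1] <-]|_ [x xF <-]].
  rewrite quotient_proj_coset //.
  have [g [gG g_neq1 gx]] : exists g, [/\ g \in G, g != 1%g &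
      torus_act rG g (lattice_coset L x) = lattice_coset L x].
    apply: contrapT => no_g; case/eqP: stab_neq1; apply/setP=> g.
    rewrite !inE; apply/andP/eqP => [[gG /asboolP gx]|->].
      by apply/eqP/negPn/negP=> g_neq1; apply: no_g; exists g.
    split; first exact: group1.
    apply/asboolP; rewrite torus_act_coset //; congr lattice_coset.
    by rewrite /complex_act repr_mx1 map_mx1 mul1mx.
  move: gx; rewrite torus_act_coset // => /lattice_coset_eq.
  case/(fixed_point_lattice_point gG g_neq1)=> w -> wF; exists (Zp w).
    by apply/bigcupP; exists g; rewrite ?gG.
  apply/esym/affine_orbit_eq/affine_orbit_lattice_point; exists 1%g => /=.
    exact: group1.
  by rewrite repr_mx1 mul1mx lift_pointK.
case/bigcupP: xF => g /andP[gG g_neq1] /fixcolP gx.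
exists (lattice_coset L (lift_point x)); last exact: quotient_proj_coset.
split; first by exists (lift_point x).
apply/eqP=> /setP/(_ g); rewrite !inE gG (negPf g_neq1) /= => /asboolP[].
rewrite (torus_act_coset _ stabL gG); apply/lattice_coset_eq.
rewrite lattice_point_act; last exact: gG.
have /lattice_point_congr[l Ll ->] :
    Zp (rZ g *m map_mx (fun a : 'Z_M => (a : nat)%:Z) x) =
    Zp (map_mx (fun a : 'Z_M => (a : nat)%:Z) x).
  by rewrite map_mxM lift_pointK.
by rewrite addrC addKr.
Qed.

(** Lifts of two columns lie in one affine orbit exactly when the columns lie in one G-orbit, so the
    two kinds of orbits are equally many. *)
Lemma card_singular_points (cycG : cyclic G) :
  finite_set (singular_points R rG L) /\
  #|` fset_set (singular_points R rG L)| =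
     #|orbit (col_action M rZ cycG) G @: singcol M rZ|.
Proof.
rewrite singular_points_lift; apply: card_fset_set_image => x y _ _.
split=> [/= eq_xy|/esym/(orbit_in_eqP (subxx G))].
  apply/esym/(orbit_in_eqP (subxx G))/orbitP.
  have : affine_orbit rG L (lift_point x) (lift_point y).
    rewrite eq_xy; apply/affine_orbit_lattice_point; exists 1%g.
      exact: group1.
    by rewrite repr_mx1 mul1mx.
  case/affine_orbit_lattice_point=> g gG; rewrite map_mxM !lift_pointK => E.
  by exists g; [exact: gG | exact: etrans (col_actionE rZ cycG x gG) E].
case/orbitP=> g gG E; apply/affine_orbit_eq/affine_orbit_lattice_point.
exists g; first exact: gG.
by rewrite map_mxM !lift_pointK; exact: etrans (esym (col_actionE rZ cycG x gG)) E.
Qed.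

End LatticeCoordinates.


(** * The closed formula *)

Lemma powR_root (R : realType) (c t p n : nat) : (0 < t)%N ->
  (c ^ t = p ^ n)%N -> (p%:R `^ (n%:R / t%:R))%R = c%:R :> R.
Proof.
move=> t_gt0 ct_pn; have t_neq0 : t%:R != 0 :> R by rewrite pnatr_eq0 -lt0n.
rewrite powRrM powR_mulrn ?ler0n // -natrX -ct_pn natrX -powR_mulrn ?ler0n //.
by rewrite -powRrM divff // powRr1 ?ler0n.
Qed.

Theorem theorem4p3 (R : realType) (gT : finGroupType) (G : {group gT})
    (m n : nat) (rG : mx_representation rat G n) (L : set 'cV[rat]_n) :
  cyclic G -> #|G| = m -> (1 < m)%N ->
  is_FPF rG -> full_rank_lattice L -> invariant_lattice rG L ->
  finite_set (singular_points R rG L) /\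
  (#|` fset_set (singular_points R rG L)|)%:R =
    1 - (size (primes m))%:R / m%:R
    + m%:R^-1 * (\sum_(p <- primes m) p%:R `^ (n%:R / (p%:R - 1)))
    + m%:R^-1 * (\sum_(p <- primes m) \sum_(1 <= k < m.+1 | (p ^ k %| m)%N)
        (totient (p ^ k))%:R
        * (p%:R `^ (n%:R / (totient (p ^ k))%:R) - 1)) :> R.
Proof.
move=> cycG cardG m_gt1 fpf latL stabL.
have [P unitP LE] := lattice_basis latL.
have [rZ rZE] := integral_repr unitP LE stabL.
have fpfZ := integral_fpf unitP rZE fpf.
pose M := (m * m)%N.
have M_gt1 : (1 < M)%N by rewrite (leq_trans m_gt1) // leq_pmull // ltnW.
have dvd_M p : (p %| #|G|)%N -> (p * p %| M)%N by rewrite cardG => ?; apply: dvdn_mul.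
have dvd1_M p : prime p -> (p %| #|G|)%N -> (p %| M)%N.
  by move=> _ /dvd_M; apply: dvdn_trans; apply: dvdn_mulr.
have [fin ->] := card_singular_points unitP LE rZE R M_gt1 stabL latL fpf dvd1_M cycG.
split=> //.
have [e eP] := cyclic_order_choice cycG.
pose c d := #|fixcol M rZ (e d)|.
have card_c g : g \in G -> #|fixcol M rZ g| = c #[g]%g.
  move=> gG; have [eG oe] := eP _ (order_dvdG gG).
  by rewrite (eq_fixcol M rZ gG (cyclic_eq_cycle cycG gG eG (esym oe))).
have cE p k : prime p -> (0 < k)%N -> (p ^ k %| m)%N ->
    p%:R `^ (n%:R / (totient (p ^ k))%:R) = (c (p ^ k)%N)%:R :> R.
  case: k => // k pr_p _ pk_m; rewrite -cardG in pk_m; have [eG oe] := eP _ pk_m.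
  apply: powR_root; first by rewrite totient_gt0 expn_gt0 prime_gt0.
  apply: (card_fixcol fpfZ M_gt1 eG pr_p) => //.
  by apply: dvd_M; apply: dvdn_trans pk_m; apply: dvdn_exp.
have m_neq0 : m%:R != 0 :> R by rewrite pnatr_eq0 -lt0n ltnW.
have G_gt1 : (1 < #|G|)%N by rewrite cardG.
have := sum_card_fixcol M rZ cycG; rewrite cardG => /(congr1 (fun k => k%:R : R)).
rewrite natrD natrM (card_singcol fpfZ cycG G_gt1 card_c).
rewrite (sum_card_fixcol_neq1 fpfZ cycG card_c) cardG.
(* Splitting off the -1 of each prime divisor produces the number of prime divisors of m. *)
rewrite sumrB big_const_seq count_predT iter_addr_0.
have -> : \sum_(p <- primes m) (c p)%:R =
    \sum_(p <- primes m) p%:R `^ (n%:R / (p%:R - 1)) :> R.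
  apply: eq_big_seq => p; rewrite mem_primes => /and3P[pr_p _ p_m].
  by rewrite -[in LHS](expn1 p) -cE ?expn1 // totient_prime // -subn1 natrB ?prime_gt0.
have -> : \sum_(p <- primes m) \sum_(1 <= k < m.+1 | (p ^ k %| m)%N)
      (totient (p ^ k))%:R * ((c (p ^ k)%N)%:R - 1) =
    \sum_(p <- primes m) \sum_(1 <= k < m.+1 | (p ^ k %| m)%N)
      (totient (p ^ k))%:R * (p%:R `^ (n%:R / (totient (p ^ k))%:R) - 1) :> R.
  apply: eq_big_seq => p; rewrite mem_primes => /and3P[pr_p _ p_m].
  rewrite big_nat_cond [RHS]big_nat_cond; apply: eq_bigr => k.
  by move=> /andP[/andP[k_gt0 _] pk_m]; rewrite cE.
set S1 := \sum_(p <- primes m) _ `^ _.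
set S2 := \sum_(p <- primes m) \sum_(_ <= _ < _ | _) _.
(* With every quantity abstracted, E is Burnside's identity 1 + (S1 - w) + (x - 1 + S2) = o x, to be
   solved for o. *)
move: S1 S2 (size _)%:R m%:R m_neq0 #|_|%:R => S1 S2 w x x_neq0 o E.
by apply: (mulIf x_neq0); rewrite -E; field.
Qed.
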